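(* Let $G=(X,Y,E)$ be a connected bipartite graph. Then $G$ is Parikh binary word representable if and only if for all $x,x'\in X$, $N(x)\subseteq N(x')$ or $N(x')\subseteq N(x)$.
   Context: $N(v)$ denotes the open neighborhood of a vertex $v$. For an ordered alphabet $\Sigma=\{a_1<\dots<a_s\}$ and a nonempty word $w=w_1\cdots w_n$ over $\Sigma$, the Parikh graph $\mathcal{G}(w)$ is the simple undirected graph on $\{1,\dots,n\}$ where, for $i<j$, $i$ and $j$ are adjacent iff $w_i=a_k$ and $w_j=a_{k+1}$ for some $1\le k\le s-1$. A graph is Parikh binary word representable if it is isomorphic to $\mathcal{G}(w)$ for some nonempty word $w$ over an ordered alphabet with exactly two letters (equivalently, over $\{a<b\}$). *)

(* Defs.v *)
From mathcomp Require Import all_boot.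

Set Implicit Arguments.
Unset Strict Implicit.
Unset Printing Implicit Defensive.

Record sgraph : Type := SGraph {
  vertex :> finType;
  adj : rel vertex;
  adj_sym : symmetric adj;
  adj_irrefl : irreflexive adj
}.

Definition neighborhood (G : sgraph) (v : G) : {set G} := [set u | adj v u].

(* The empty graph does not count as connected. *)
Definition connected_graph (G : sgraph) : Prop :=
  0 < #|G| /\ forall u v : G, connect (@adj G) u v.

(* Either part may be empty, as for the one-vertex graph. *)
Definition bipartition (G : sgraph) (X Y : {set G}) : Prop :=
  [/\ X :&: Y = set0, X :|: Y = [set: G] &
      forall u v : G, adj u v ->
        (u \in X /\ v \in Y) \/ (u \in Y /\ v \in X)].

Definition isomorphic (G H : sgraph) : Prop :=
  exists2 f : G -> H, bijective f & forall u v : G, adj (f u) (f v) = adj u v.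

(* The ordered alphabet a_1 < ... < a_s is 'I_s, with a_k encoded as k - 1;
   positions of a word are likewise numbered from 0. *)
Definition parikh_arc (s n : nat) (w : n.-tuple 'I_s) : rel 'I_n :=
  fun i j => (i < j) && (tnth w j == (tnth w i).+1 :> nat).

Definition parikh_adj (s n : nat) (w : n.-tuple 'I_s) : rel 'I_n :=
  fun i j => parikh_arc w i j || parikh_arc w j i.

Lemma parikh_adj_sym (s n : nat) (w : n.-tuple 'I_s) :
  symmetric (parikh_adj w).
Proof. by move=> i j; rewrite /parikh_adj orbC. Qed.

Lemma parikh_adj_irrefl (s n : nat) (w : n.-tuple 'I_s) :
  irreflexive (parikh_adj w).
Proof. by move=> i; rewrite /parikh_adj /parikh_arc ltnn. Qed.

Definition parikh_graph (s n : nat) (w : n.-tuple 'I_s) : sgraph :=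
  SGraph (parikh_adj_sym w) (parikh_adj_irrefl w).

(* A word over the two-letter alphabet need not use both letters. *)
Definition parikh_binary_representable (G : sgraph) : Prop :=
  exists (n : nat) (w : n.-tuple 'I_2), 0 < n /\ isomorphic G (parikh_graph w).

(* Main.v *)
Require Import Defs.
From mathcomp Require Import all_boot.

(** In a binary word the neighborhood of a position carrying [a] (resp. [b]) is
    the set of later [b]'s (resp. earlier [a]'s), so positions with the same
    letter have nested neighborhoods; in a connected bipartite graph the letter
    of a vertex is determined by its part. Conversely, list [X] by decreasing
    neighborhoods, write [a] for each [x] in [X], and insert a [b] for each [y]
    outside [X] right after the last of its neighbors. *)

Lemma ord2_eq_succ (a b : 'I_2) :
  (b == a.+1 :> nat) = (a == ord0) && (b != ord0).
Proof. by case: a => [[|[|]]] //; case: b => [[|[|]]]. Qed.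

Lemma parikh_adjE (n : nat) (w : n.-tuple 'I_2) (i j : 'I_n) :
  parikh_adj w i j =
  (if tnth w i == ord0 then (i < j) && (tnth w j != ord0)
   else (j < i) && (tnth w j == ord0)).
Proof.
rewrite /parikh_adj /parikh_arc !ord2_eq_succ.
by case: (tnth w i == ord0); case: (tnth w j == ord0);
  rewrite ?andbF ?andbT ?orbF.
Qed.

Lemma parikh_nested {n : nat} {w : n.-tuple 'I_2} {i j : 'I_n} :
  (tnth w i == ord0) = (tnth w j == ord0) ->
  (forall k, parikh_adj w i k -> parikh_adj w j k) \/
  (forall k, parikh_adj w j k -> parikh_adj w i k).
Proof.
move=> eq_ij; wlog le_ij: i j eq_ij / i <= j => [hw|].
  by case: (leqP i j) => [|/ltnW] /hw[] //; [left | right | right | left].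
(* Moving right shrinks the neighborhood of an [a] and enlarges that of a [b]. *)
case wj: (tnth w j == ord0) in eq_ij.
- right=> k; rewrite !parikh_adjE wj eq_ij => /andP[lt_jk ->].
  by rewrite (leq_ltn_trans le_ij).
- left=> k; rewrite !parikh_adjE wj eq_ij => /andP[lt_ki ->].
  by rewrite (leq_trans lt_ki).
Qed.

Lemma bipartition_adj {G : sgraph} {X Y : {set G}} {u v : G} :
  bipartition X Y -> adj u v -> (v \in X) = (u \notin X).
Proof.
case=> XY0 _ hadj /hadj.
have inY z : z \in Y -> z \in X = false.
  by move=> zY; have := in_set0 z; rewrite -XY0 inE zY andbT.
by case=> -[] => [uX /inY -> | /inY -> ->]; rewrite ?uX.
Qed.

Lemma representable_nested {G : sgraph} {X Y : {set G}} :
  bipartition X Y -> connected_graph G -> parikh_binary_representable G ->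
  forall x x' : G, x \in X -> x' \in X ->
    neighborhood x \subset neighborhood x' \/
    neighborhood x' \subset neighborhood x.
Proof.
move=> hXY [_ conn] [n [w [_ [f _ fadj]]]] x x' xX x'X.
(* Along an edge both the part and the letter change, so whether they agree is invariant. By
   connectivity it is constant on [G], hence [x] and [x'] carry the same letter. *)
have cl : closed (@adj G) [pred u | (u \in X) == (tnth w (f u) == ord0)].
  move=> u v auv; rewrite !inE (bipartition_adj hXY auv).
  have := auv; rewrite -fadj /= parikh_adjE.
  by case: eqP => _ /andP[_ wv]; rewrite ?(negbTE wv) ?wv; case: (u \in X).
have /parikh_nested : (tnth w (f x) == ord0) = (tnth w (f x') == ord0).
  have := closed_connect cl (conn x x'); rewrite !inE xX x'X.
  by do 2 case: eqP.
case=> nest; [left | right]; apply/subsetP=> z; rewrite !inE -!fadj; exact: nest.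
Qed.

(** Sorting the vertices by [k] and writing [a] on [X], [b] elsewhere gives the word. The sort
    orders equal keys arbitrarily, which is harmless within a part; hence ties are excluded only
    across parts. *)
Lemma key_representable (G : sgraph) (X : {set G}) (k : G -> nat) :
  0 < #|G| ->
  (forall u v, u \in X -> v \in X -> ~~ adj u v) ->
  (forall u v, u \notin X -> v \notin X -> ~~ adj u v) ->
  (forall u v, u \in X -> v \notin X -> k u != k v) ->
  (forall u v, u \in X -> v \notin X -> adj u v = (k u < k v)) ->
  parikh_binary_representable G.
Proof.
move=> G_gt0 XX YY kneq kadj.
pose le := relpre k leq.
pose s := sort_tuple le (enum_tuple G).
pose letter u : 'I_2 := if u \in X then ord0 else ord_max.
have letter0 u : (letter u == ord0) = (u \in X).
  by rewrite /letter; case: (u \in X).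
have s_uniq : uniq s by rewrite sort_uniq enum_uniq.
have sP u : u \in s by rewrite mem_sort mem_enum.
have idx_lt u : index u s < #|G| by rewrite -[X in _ < X](size_tuple s) index_mem.
pose f u := Ordinal (idx_lt u).
have fK : cancel f (tnth s) by move=> u; rewrite (tnth_nth u) nth_index.
have gK : cancel (tnth s) f.
  by move=> i; apply: val_inj; rewrite /= (tnth_nth (tnth s i)) index_uniq ?size_tuple.
have mono u v : f u <= f v -> k u <= k v.
  move=> le_uv; rewrite -(fK u) -(fK v) !(tnth_nth u).
  apply: (@sorted_leq_nth _ le) => //; rewrite ?inE ?size_tuple //.
  - by move=> y x z; apply: leq_trans.
  - by move=> x; apply: leqnn.
  - by apply: sort_sorted => x y; apply: leq_total.
have f_lt u v : u \in X -> v \notin X -> (f u < f v) = adj u v.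
  move=> uX vY; rewrite kadj //; apply/idP/idP.
    by move/ltnW/mono; rewrite leq_eqVlt (negbTE (kneq u v uX vY)).
  by apply: contraTT; rewrite -!leqNgt; apply: mono.
exists #|G|, (map_tuple letter s); split=> //.
exists f; first by exists (tnth s).
move=> u v; rewrite /= parikh_adjE !tnth_map !fK !letter0.
case: ifPn => uX; case: (boolP (v \in X)) => vX; rewrite ?andbT ?andbF.
- by apply/esym/negbTE/XX.
- exact: f_lt.
- by rewrite f_lt // adj_sym.
- by apply/esym/negbTE/YY.
Qed.

Lemma nested_representable {G : sgraph} {X Y : {set G}} :
  bipartition X Y -> 0 < #|G| ->
  (forall x x' : G, x \in X -> x' \in X ->
    neighborhood x \subset neighborhood x' \/
    neighborhood x' \subset neighborhood x) ->
  parikh_binary_representable G.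
Proof.
move=> hXY G_gt0 nest.
(* Counting non-neighbors makes increasing [c] list [X] by decreasing neighborhoods. The key of a
   vertex outside [X] is one more than that of its last neighbor, or 0 if it has none. *)
pose c (u : G) := #|~: neighborhood u|.
(* Odd keys on [X] and even keys outside [X] rule out ties. *)
pose k u := if u \in X then (c u).*2.+1
            else (\max_(x in neighborhood u) (c x).+1).*2.
apply: (@key_representable G X k) => // u v.
- by move=> uX vX; apply/negP=> /(bipartition_adj hXY); rewrite uX vX.
- by move=> uX vX; apply/negP=> /(bipartition_adj hXY); rewrite uX (negbTE vX).
- move=> uX vX; rewrite /k uX (negbTE vX); apply/eqP=> /(congr1 odd).
  by rewrite /= !odd_double.
move=> uX vX; rewrite /k uX (negbTE vX) -doubleS leq_double; apply/idP/idP.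
  by move=> auv; apply: leq_bigmax_cond; rewrite inE adj_sym.
(* An empty maximum is 0 and exceeds nothing, so [v] has a neighbor, and some neighbor [x] attains
   the maximum. *)
move=> lt_uv; have [x0 x0v] : exists x0, x0 \in neighborhood v.
  apply/existsP; apply: contraLR lt_uv => /existsPn no_nbr.
  by rewrite big_pred0 // => x; apply: negbTE.
have /(eq_bigmax_cond (fun x => (c x).+1)) [x xv max_eq] :
  0 < #|neighborhood v| by apply/card_gt0P; exists x0.
move: lt_uv xv; rewrite max_eq ltnS inE => le_ux avx.
have xX : x \in X by rewrite (bipartition_adj hXY avx).
suff /subsetP/(_ v) : neighborhood x \subset neighborhood u.
  by rewrite !inE => -> //; rewrite adj_sym.
(* If instead [u] has the smaller neighborhood, then [c u <= c x] forces the two neighborhoods to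
   coincide. *)
case: (nest x u xX uX) => //; rewrite -setCS => sub.
by rewrite -setCS (eqP (_ : ~: neighborhood x == ~: neighborhood u)) // eqEcard sub.
Qed.

Theorem theorem6p1 (G : sgraph) (X Y : {set G})
    (hXY : bipartition X Y) (hG : connected_graph G) :
  parikh_binary_representable G <->
  (forall x x' : G, x \in X -> x' \in X ->
     neighborhood x \subset neighborhood x' \/
     neighborhood x' \subset neighborhood x).
Proof.
split; first exact: (representable_nested hXY hG).
exact: (nested_representable hXY (proj1 hG)).
Qed.
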